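(* Let $N\ge2$ and let $a:\mathbb{R}^N\to\mathbb{R}$ be a continuous Bohr almost periodic function with $\theta\le a(x)\le\Theta$ for all $x\in\mathbb{R}^N$, where $0<\theta<\Theta$. For each $\nu\in\mathbb{S}^{N-1}$ there exists a unique $c(\nu)\in[\sqrt\theta,\sqrt\Theta]$ such that for all compact $K\subseteq\mathbb{R}^N$, $$\lim_{T\to\infty}\sup_{x\in K}\Big|\frac1T h_\nu(Tx)-c(\nu)(x\cdot\nu)\Big|=0,$$ and $c(\nu)=c(-\nu)$.
   Context: Bohr almost periodicity: a continuous bounded function $g:\mathbb{R}^d\to\mathbb{R}$ is Bohr almost periodic if for every $\eta>0$ there exists $\tau>0$ such that for any $\alpha\in\mathbb{R}^d$ there exists $\zeta\in\alpha+\tau\blacksquare_d$ with $\sup_{x\in\mathbb{R}^d}|g(x+\zeta)-g(x)|\le\eta$, where $\blacksquare_d$ is any $d$-dimensional unit cube; equivalently, the family of translates $\{g(\cdot+z):z\in\mathbb{R}^d\}$ is relatively compact in $\|\cdot\|_\infty$. $\Sigma_\nu=\{x\in\mathbb{R}^N:x\cdot\nu=0\}$. For $y_0,y_1\in\mathbb{R}^N$, $d_{\sqrt a}(y_0,y_1):=\inf_\gamma\int_0^1\sqrt{a(\gamma(t))}\,|\dot\gamma(t)|\,dt$, where the infimum is over Lipschitz curves $\gamma:[0,1]\to\mathbb{R}^N$ with $\gamma(0)=y_0$, $\gamma(1)=y_1$. The signed distance function to $\Sigma_\nu$ is $h_\nu(y):=\mathrm{sign}(y\cdot\nu)\inf_{z\in\Sigma_\nu}d_{\sqrt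 a}(y,z)$. *)

(* Defs.v *)
From HB Require Import structures.
From mathcomp Require Import all_boot all_order all_algebra.
From mathcomp Require Import all_classical all_reals all_analysis.

Set Implicit Arguments.
Unset Strict Implicit.
Unset Printing Implicit Defensive.

Import Order.TTheory GRing.Theory Num.Theory.
Import numFieldNormedType.Exports.

Local Open Scope classical_set_scope.
Local Open Scope ring_scope.

Section Defs.
Context {R : realType} {N : nat}.
Implicit Types (x y z nu : 'rV[R]_N) (a g : 'rV[R]_N -> R).

Definition dot x y : R := \sum_i x ord0 i * y ord0 i.

(* The library norm on ['rV[R]_N] is the max norm; this is the Euclidean one. *)
Definition enorm x : R := Num.sqrt (dot x x).

(* Supremum of [|f|] over [K], taken in [0, +oo]: it is [0] for empty [K] and
   [+oo] when [f] is unbounded on [K]. *)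
Definition sup_on (K : set 'rV[R]_N) (f : 'rV[R]_N -> R) : \bar R :=
  ereal_sup (0%E |` [set `|f x|%:E | x in K]).

(* The closed cube [alpha + tau * [-1/2, 1/2]^N]. *)
Definition cube (alpha : 'rV[R]_N) (tau : R) : set 'rV[R]_N :=
  [set zeta | forall i, `|zeta ord0 i - alpha ord0 i| <= tau / 2].

Definition bohr_almost_periodic g : Prop :=
  [/\ continuous g, bounded_fun g &
    forall eta : R, 0 < eta -> exists2 tau : R, 0 < tau &
      forall alpha, exists2 zeta, cube alpha tau zeta &
        (sup_on setT (fun x => (g (x + zeta) - g x)%R) <= eta%:E)%E].

Definition hyperplane nu : set 'rV[R]_N := [set x | dot x nu = 0].

(* Curves are total functions constrained only on [0, 1].  Lipschitz is for the
   max norm, which is equivalent to the Euclidean one. *)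
Definition lipschitz_curve y0 y1 (gamma : R -> 'rV[R]_N) : Prop :=
  [/\ [lipschitz gamma t | t in `[0, 1]], gamma 0 = y0 & gamma 1 = y1].

(* [derive1 gamma] is meaningful almost everywhere on [0, 1] (Rademacher). *)
Definition weighted_length a (gamma : R -> 'rV[R]_N) : \bar R :=
  (\int[lebesgue_measure]_(t in `[0%R, 1%R])
     (Num.sqrt (a (gamma t)) * enorm (derive1 gamma t))%R%:E)%E.

Definition dist_sqrt a y0 y1 : \bar R :=
  ereal_inf [set weighted_length a gamma | gamma in lipschitz_curve y0 y1].

(* [fine] loses nothing: for bounded [a] the infimum is finite, since [0] lies in the
   hyperplane and segments have finite weighted length. *)
Definition signed_dist a nu y : R :=
  Num.sg (dot y nu) *
    fine (ereal_inf [set dist_sqrt a y z | z in hyperplane nu]).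

End Defs.

(* Main.v *)
From HB Require Import structures.
Require Import Defs.
From mathcomp Require Import all_boot all_order all_algebra.
From mathcomp Require Import all_classical all_reals all_analysis.
From mathcomp Require Import measurable_realfun ring lra.

Set Implicit Arguments.
Unset Strict Implicit.
Unset Printing Implicit Defensive.

(** Let D(y, u) be the weighted distance from y to the hyperplane {z : (y - z).nu = u}, and
    M(u) its supremum over y.  By the triangle inequality M is subadditive, so M(u)/u has a
    limit c as u grows (Fekete).  Translating a path by an almost period of a multiplies its
    length by at most 1 + e, and an almost period lies within a bounded distance of any
    vector; hence M(u) <= (1 + e) D(y, u) + C_e for every y, and D(y, u) is c u up to e u + C_e,
    uniformly in y.  Reversing paths relates u to - u.  The signed distance to the hyperplane
    is D(y, y.nu) up to sign, so rescaling gives the limit.  The bound c >= sqrt theta and the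
    calculus of lengths rest on the fact that a Lipschitz function is the integral of its
    almost everywhere derivative. *)

Import Order.TTheory GRing.Theory Num.Theory.
Import numFieldNormedType.Exports.
Import HBNNSimple.

Local Open Scope classical_set_scope.
Local Open Scope ring_scope.

(** * Comparison of lower integrals with measurable comparison functions *)

Section LowerIntegral.
Context d (T : measurableType d) (R : realType).
Variable mu : {measure set T -> \bar R}.
Local Open Scope ereal_scope.

(* The library integral of a nonnegative function is a supremum over simple functions,
   so the next lemmas need no measurability of [f]. *)
Lemma ge0_le_integral_nonmeasurable (D : set T) (f g : T -> \bar R) :
  (forall x, D x -> 0 <= f x) -> (forall x, D x -> f x <= g x) ->
  \int[mu]_(x in D) f x <= \int[mu]_(x in D) g x.
Proof.
move=> f0 fg.
have g0 x : D x -> 0 <= g x by move=> Dx; exact: le_trans (f0 _ Dx) (fg _ Dx).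
rewrite !ge0_integralE//; apply: ereal_sup_le => _ [h hf <-].
exists h => // x; apply: le_trans (hf x) _.
by rewrite !patchE; case: ifPn => // /set_mem; exact: fg.
Qed.

(** A simple function below [f] is almost everywhere below [w], so its integral is at most that of
    [w]; taking the supremum over such functions gives the bound. *)
Lemma integral_le_measurable_ae (D : set T) (f w : T -> \bar R) :
  measurable D -> measurable_fun D w ->
  (forall x, D x -> 0 <= f x) -> (forall x, D x -> 0 <= w x) ->
  {ae mu, forall x, D x -> f x <= w x} ->
  \int[mu]_(x in D) f x <= \int[mu]_(x in D) w x.
Proof.
move=> mD mw f0 w0 fw.
rewrite (ge0_integralE mu f0); apply: ge_ereal_sup => _ [h hf <-].
rewrite -integralT_nnsfun.
rewrite (@le_trans _ _ (\int[mu]_(x in setT) (w \_ D) x))//; last first.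
  by rewrite -integral_mkcond.
apply: ae_ge0_le_integral => //.
- by move=> x _; rewrite lee_fin fun_ge0.
- exact/measurable_EFinP/measurable_funP.
- by move=> x _; apply: erestrict_ge0 => y; exact: w0.
- by apply/(measurable_restrictT _ _).1.
case: fw => N [mN N0 fwN]; exists N; split=> // x /= hxw; apply: fwN => /= fwx.
apply: hxw => _; apply: le_trans (hf x) _; rewrite !patchE.
by case: ifPn => // /set_mem; exact: fwx.
Qed.

(** Multiplying [w] by the indicator of the complement of the null set keeps its integral and makes
    the inequality hold everywhere. *)
Lemma measurable_ae_le_integral (D : set T) (f w : T -> \bar R) :
  measurable D -> measurable_fun D w ->
  (forall x, D x -> 0 <= f x) -> (forall x, D x -> 0 <= w x) ->
  {ae mu, forall x, D x -> w x <= f x} ->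
  \int[mu]_(x in D) w x <= \int[mu]_(x in D) f x.
Proof.
move=> mD mw f0 w0 [N [mN N0 wfN]].
have mw' : measurable_fun D (fun x => w x * (\1_(~` N) x)%:E).
  apply: emeasurable_funM => //; apply/measurable_EFinP.
  by apply: measurable_funTS; apply: measurable_indic; exact: measurableC.
have -> : \int[mu]_(x in D) w x =
    \int[mu]_(x in D) (w x * (\1_(~` N) x)%:E).
  apply: ae_eq_integral => //; exists N; split=> // x /=.
  apply: contra_notP => Nx _; rewrite indicE mem_set ?mule1//.
apply: ge0_le_integral_nonmeasurable => x Dx.
  by rewrite mule_ge0 ?lee_fin ?w0.
have [Nx|Nx] := pselect (N x).
  by rewrite indicE memNset ?mule0 ?f0//; exact.
rewrite indicE mem_set// mule1; apply: contra_notP Nx => wf; apply: wfN => /=.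
by move/(_ Dx).
Qed.

Lemma ge0_ae_eq_integral_nonmeasurable (D : set T) (f w : T -> \bar R) :
  measurable D -> measurable_fun D w ->
  (forall x, D x -> 0 <= f x) -> (forall x, D x -> 0 <= w x) ->
  {ae mu, forall x, D x -> f x = w x} ->
  \int[mu]_(x in D) f x = \int[mu]_(x in D) w x.
Proof.
move=> mD mw f0 w0 fw; apply/eqP; rewrite eq_le; apply/andP; split.
- apply: integral_le_measurable_ae => //.
  by apply: filterS fw => x fw /fw ->.
- apply: measurable_ae_le_integral => //.
  by apply: filterS fw => x fw /fw ->.
Qed.

End LowerIntegral.

(** * Lebesgue measure and integrals under affine substitutions *)

Section AffineChangeOfVariables.
Context {R : realType}.
Notation mu := (@lebesgue_measure R).
Variables k b : R.

Let affine (t : R) : R := k * t + b.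

Lemma measurable_affine : measurable_fun setT affine.
Proof.
apply: continuous_measurable_fun => t.
by apply: cvgD; [apply: cvgM; [exact: cvg_cst|exact: cvg_id]|exact: cvg_cst].
Qed.

Let affine_pushforward :=
  @measure_function_pushforward__canonical__measure_function_Measure
    _ _ (measurableTypeR R) (measurableTypeR R) R mu affine measurable_affine.

(** The right-hand side is a measure in [A] that agrees with Lebesgue measure on half-open
    intervals, hence everywhere by uniqueness. *)
Lemma lebesgue_measure_affine (A : set R) : k != 0 -> measurable A ->
  mu A = (`|k|%:E * mu (affine @^-1` A))%E.
Proof.
move=> k0 mA.
pose nu := mscale (NngNum (normr_ge0 k)) affine_pushforward.
rewrite -[RHS]/(nu A).
apply: (lebesgue_measure_unique (mu := nu)) => // _ [[x y]] /= _ <-.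
rewrite -[RHS]/(`|k|%:E * mu (affine @^-1` `]x, y]))%E.
rewrite lebesgue_measure_itv/= lte_fin.
have [xy|yx] := ltP x y; last first.
  rewrite set_itv_ge ?bnd_simp -?leNgt//.
  by rewrite -[X in mu X]/set0 measure0 mule0.
have [kp|kn|k00] := ltgtP k 0; last by rewrite k00 eqxx in k0.
(* A negative slope swaps the end points, so the preimage is closed on the left instead of on the
   right. *)
- have -> : affine @^-1` `]x, y] = `[(y - b) / k, (x - b) / k[%classic.
    apply/seteqP; split=> t /=; rewrite /affine !in_itv/= ler_ndivrMr// ltr_ndivlMr//.
      by move=> /andP[? ?]; apply/andP; split; lra.
    by move=> /andP[? ?]; apply/andP; split; lra.
  rewrite lebesgue_measure_itv/= lte_fin ltr_ndivrMr// divfK// ifT; last by lra.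
  by rewrite -EFinM ltr0_norm//; congr EFin; field.
- have -> : affine @^-1` `]x, y] = `](x - b) / k, (y - b) / k]%classic.
    apply/seteqP; split=> t /=; rewrite /affine !in_itv/= ler_pdivlMr// ltr_pdivrMr//.
      by move=> /andP[? ?]; apply/andP; split; lra.
    by move=> /andP[? ?]; apply/andP; split; lra.
  rewrite lebesgue_measure_itv/= lte_fin ltr_pdivrMr// divfK// ifT; last by lra.
  by rewrite -EFinM gtr0_norm//; congr EFin; field.
Qed.

Lemma negligible_affine (A : set R) : k != 0 -> mu.-negligible A ->
  mu.-negligible (affine @^-1` A).
Proof.
move=> k0 [B [mB B0 AB]]; exists (affine @^-1` B); split.
- by rewrite -[X in measurable X]setTI; exact: measurable_affine.
- move: B0; rewrite (lebesgue_measure_affine k0 mB) => /eqP.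
  by rewrite mule_eq0 eqe normr_eq0 (negbTE k0) /= => /eqP.
- by move=> t /AB.
Qed.

Lemma ge0_integral_affine (D : set R) (w : R -> \bar R) : k != 0 ->
  measurable D -> measurable_fun D w -> (forall x, D x -> 0 <= w x)%E ->
  (\int[mu]_(x in D) w x =
   `|k|%:E * \int[mu]_(t in affine @^-1` D) w (k * t + b)%R)%E.
Proof.
move=> k0 mD mw w0.
pose nu := mscale (NngNum (normr_ge0 k)) affine_pushforward.
rewrite -[X in (_ * X)%E](@ge0_integral_pushforward _ _ (measurableTypeR R) (measurableTypeR R) R affine measurable_affine mu D w)//.
  rewrite -[LHS](_ : (\int[nu]_(x in D) w x)%E = _).
    by rewrite (@ge0_integral_mscale _ _ _ affine_pushforward _ mD (NngNum (normr_ge0 k)))//.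
  apply: eq_measure_integral => A mA AD.
  exact/esym/lebesgue_measure_affine.
by move=> y /set_mem; exact: w0.
Qed.

End AffineChangeOfVariables.

(** * Nondecreasing Lipschitz functions as integrals of a density *)

Section LipschitzDensity.
Context {R : realType}.
Notation mu := (@lebesgue_measure R).

Lemma lebesgue_stieltjes_measure_itvoc (F : cumulative R R) (x y : R) : x <= y ->
  lebesgue_stieltjes_measure F `]x, y]%classic = (F y - F x)%:E.
Proof.
move=> xy; rewrite /lebesgue_stieltjes_measure/= /measure_extension/=.
rewrite measurable_mu_extE//; last exact: is_ocitv.
rewrite -[LHS]/(wlength F `]x, y]%classic) wlength_itv/= lte_fin; case: ltgtP xy => // -> _.
by rewrite subrr.
Qed.

Lemma lipschitz_right_continuous (F : R -> R) (L : R) :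
  (forall x y, `|F x - F y| <= L * `|x - y|) -> right_continuous F.
Proof.
move=> FL; apply: right_continuousW => x.
apply/cvgrPdist_lt => e e0; near=> y.
apply: le_lt_trans (FL x y) _.
apply: (@le_lt_trans _ _ ((`|L| + 1) * `|x - y|)).
  by rewrite ler_wpM2r// (le_trans (ler_norm L))// lerDl.
rewrite mulrC -ltr_pdivlMr ?ltr_wpDl//.
by near: y; apply: cvgr_dist_lt => //; rewrite divr_gt0// ltr_wpDl.
Unshelve. all: by end_near. Qed.

(* With [F] and [L id - F] both nondecreasing, the Stieltjes measures of these
   functions add up to [L] times the Lebesgue measure. *)
Lemma stieltjes_null_dominates (F H : cumulative R R) (L : R) : 0 < L ->
  (forall x, F x + H x = L * x) -> lebesgue_stieltjes_measure F `<< mu.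
Proof.
move=> L0 FH; apply/null_content_dominatesP => A mA A0.
pose Li := NngNum (ltW (divr_gt0 ltr01 L0)).
pose nu := mscale Li (measure_add (lebesgue_stieltjes_measure F)
  (lebesgue_stieltjes_measure H)).
have nuD B : nu B = ((1 / L)%:E * (lebesgue_stieltjes_measure F B
    + lebesgue_stieltjes_measure H B))%E.
  by rewrite -measure_addE.
have nuE : mu A = nu A.
  apply: (lebesgue_measure_unique (mu := nu)) => // _ [[x y]] /= _ <-.
  have [xy|yx] := ltP x y; last by rewrite set_itv_ge ?bnd_simp -?leNgt// !measure0.
  rewrite -[RHS]/(nu `]x, y]%classic) nuD !lebesgue_stieltjes_measure_itvoc ?ltW//.
  rewrite lebesgue_measure_itv/= lte_fin xy -!EFinD -EFinM; congr EFin.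
  have := FH x; have := FH y => h1 h2.
  have -> : F y - F x + (H y - H x) = L * (y - x) by rewrite mulrBr -h1 -h2; ring.
  by field; rewrite gt_eqF.
move: nuE; rewrite A0 nuD => /esym/eqP.
rewrite mule_eq0 eqe gt_eqF ?divr_gt0//= padde_eq0 ?measure_ge0//.
by move=> /andP[/eqP].
Qed.

(** The density is the Radon-Nikodym derivative of the Stieltjes measure of [F], which is absolutely
    continuous because [L * x - F x] is nondecreasing as well. *)
Lemma nondecreasing_lipschitz_density (F : R -> R) (L : R) : 0 < L ->
  nondecreasing F -> (forall x y, x <= y -> F y - F x <= L * (y - x)) ->
  exists g : R -> R, mu.-integrable setT (EFin \o g) /\
    (forall x, 0 <= x <= 1 ->
      F x - F 0 = \int[mu]_(t in `]0, x]) g t)%R.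
Proof.
move=> L0 ndF FL.
have FH x y : x <= y -> `|F x - F y| <= L * `|x - y|.
  move=> xy; rewrite ler0_norm ?subr_le0 ?ndF//.
  by rewrite ler0_norm ?subr_le0// !opprB FL.
have FLip x y : `|F x - F y| <= L * `|x - y|.
  have [xy|/ltW yx] := leP x y; first exact: FH.
  by rewrite distrC (distrC x); exact: FH.
pose H x := L * x - F x.
have ndH : nondecreasing H.
  by move=> x y xy; rewrite /H; have := FL _ _ xy; lra.
have HLip x y : `|H x - H y| <= (L + L) * `|x - y|.
  have -> : H x - H y = L * (x - y) - (F x - F y) by rewrite /H; ring.
  rewrite (le_trans (ler_normB _ _))// normrM gtr0_norm// mulrDl lerD2l.
  exact: FLip.
pose mF := isCumulative.Build R _ R F ndF (lipschitz_right_continuous FLip).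
pose mH := isCumulative.Build R _ R H ndH (lipschitz_right_continuous HLip).
pose cF : cumulative R R := HB.pack F mF.
pose cH : cumulative R R := HB.pack H mH.
have dom := @stieltjes_null_dominates cF cH L L0 (fun x => subrKC _ _).
have m01 : measurable (`]0%R, 1%R]%classic : set (measurableTypeR R)) by exact: measurable_itv.
have fin01 : (lebesgue_stieltjes_measure cF `]0%R, 1%R]%classic < +oo)%E.
  by rewrite lebesgue_stieltjes_measure_itvoc// ltry.
(* Restricting to the unit interval makes the Stieltjes measure finite, as Radon-Nikodym is applied
   to a finite measure. *)
pose nu := mfrestr m01 fin01.
have domnu : nu `<< mu.
  apply/null_content_dominatesP => A mA A0.
  have /null_content_dominatesP dom' := dom.
  apply/eqP; rewrite -measure_le0 -(dom' A mA A0).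
  apply: (le_measure (lebesgue_stieltjes_measure cF)); rewrite ?inE//.
  exact: measurableI.
have [g [g0 gfin gint gE]] := radon_nikodym_sigma_finite domnu.
have gfine : EFin \o (fine \o g) = g.
  by apply/funext => x /=; rewrite fineK// gfin.
exists (fine \o g); split; first by rewrite gfine.
move=> x /andP[x0 x1].
rewrite /Rintegral.
have -> : (\int[mu]_(t in `]0%R, x]) ((fine \o g) t)%:E = \int[mu]_(t in `]0%R, x]) g t)%E.
  by apply: eq_integral => t _; rewrite -[in RHS]gfine.
rewrite -gE; last exact: measurable_itv.
rewrite -[X in fine X]/(lebesgue_stieltjes_measure cF (`]0, x]%classic `&` `]0, 1]%classic)).
rewrite setIidl.
  by rewrite lebesgue_stieltjes_measure_itvoc.
by move=> t /=; rewrite !in_itv/= => /andP[-> /le_trans->].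
Qed.

End LipschitzDensity.

(** * The fundamental theorem of calculus for Lipschitz functions on the unit interval *)

Section LipschitzFTC.
Context {R : realType}.
Notation mu := (@lebesgue_measure R).

(** The 1-Lipschitz retraction of the line onto the unit interval; composing with it extends
    functions that are controlled only there. *)
Definition clamp (x : R) : R := if x <= 0 then 0 else if x <= 1 then x else 1.

Lemma clamp_itv x : 0 <= clamp x <= 1.
Proof. by rewrite /clamp; case: (leP x 0) => ?; [|case: (leP x 1) => ?]; lra. Qed.

Lemma clamp_id x : 0 <= x <= 1 -> clamp x = x.
Proof. by rewrite /clamp; case: (leP x 0) => ?; [|case: (leP x 1) => ?]; lra. Qed.

Lemma clamp_nondecreasing x y : x <= y -> 0 <= clamp y - clamp x <= y - x.
Proof.
move=> xy; rewrite /clamp.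
by case: (leP x 0) => ?; case: (leP y 0) => ?; case: (leP x 1) => ?;
  case: (leP y 1) => ?; lra.
Qed.

Lemma integrable_cst_itv01 (c : R) : mu.-integrable `[0, 1] (EFin \o cst c).
Proof.
apply: continuous_compact_integrable; first exact: segment_compact.
by move=> x; exact: cvg_cst.
Qed.

(** Adding a steep enough linear function makes [f] nondecreasing. The density of the sum, minus the
    added slope, is a density of [f], and Lebesgue differentiation identifies it with the derivative
    almost everywhere. *)
Lemma lipschitz_density (f : R -> R) (M : R) :
  (forall x y, 0 <= x <= 1 -> 0 <= y <= 1 -> `|f x - f y| <= M * `|x - y|) ->
  exists g : R -> R, [/\ measurable_fun setT g,
    mu.-integrable `[0, 1] (EFin \o g),
    {ae mu, forall t, `]0, 1[%classic t -> derivable f t 1 /\ derive1 f t = g t} &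
    f 1 - f 0 = (\int[mu]_(t in `[0, 1]) g t)%R].
Proof.
move=> fM.
have M0 : 0 <= M.
  have := fM 0 1; rewrite sub0r normrN normr1 mulr1 => h.
  by apply: le_trans (h _ _) => //; lra.
(* Slope [M] already gives monotonicity; the extra 1 keeps the Lipschitz constant [L + L] of [F]
   positive when [M] is 0. *)
pose L := M + 1.
pose F x := L * clamp x + f (clamp x).
have fF x : 0 <= x <= 1 -> F x = L * x + f x by move=> x01; rewrite /F clamp_id.
have key x y : x <= y -> `|f (clamp y) - f (clamp x)| <= M * (clamp y - clamp x).
  move=> xy; rewrite (le_trans (fM _ _ (clamp_itv _) (clamp_itv _)))//.
  by rewrite ger0_norm//; case/andP: (clamp_nondecreasing xy).
have L20 : 0 < L + L by rewrite /L; lra.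
have ndF : nondecreasing F.
  move=> x y xy; have := key _ _ xy; have /andP[c0 _] := clamp_nondecreasing xy.
  rewrite ler_norml /F /L => /andP[h _]; rewrite -subr_ge0.
  lra.
have FL x y : x <= y -> F y - F x <= (L + L) * (y - x).
  move=> xy; have := key _ _ xy; have /andP[c0 c1] := clamp_nondecreasing xy.
  rewrite ler_norml /F /L => /andP[_ h].
  by have := ler_wpM2l M0 c1; lra.
have [g0 [g0int g0E]] := nondecreasing_lipschitz_density L20 ndF FL.
have mg0 : measurable_fun setT g0.
  by apply/measurable_EFinP; exact: measurable_int g0int.
have g0itv (A : set R) : measurable A -> mu.-integrable A (EFin \o g0).
  by move=> mA; apply: integrableS g0int.
exists (fun t => g0 t - L); split.
- exact: measurable_funB.
- rewrite -[X in mu.-integrable _ X]/((EFin \o g0) \- (EFin \o cst L))%E.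
  by apply: integrableB => //; [exact: g0itv|exact: integrable_cst_itv01].
- have locg0 : locally_integrable setT g0.
    by apply: open_integrable_locally => //; exact: openT.
  have := @FTC1 R g0 (BRight 0) (fun y => g0itv _ (measurable_itv _)) locg0.
  apply: filterS; first exact: (ae_filter_ringOfSetsType mu).
  move=> t h; rewrite /= in_itv/= => /andP[t0 t1].
  have {h}[d1 d2] := h t0.
  set G := (fun x => _) in d1 d2.
  (* Inside the unit interval the clamp is the identity, so [f] is locally the primitive [G] plus an
     affine function and inherits its derivative. *)
  have fE : \forall s \near t, G s + (F 0 - L * s) = f s.
    near=> s.
    have : s \in `]0, 1[ by near: s; apply: near_in_itvoo; rewrite in_itv/= t0.
    rewrite in_itv/= => s01.
    have s01' : 0 <= s <= 1 by lra.
    by rewrite /G -(g0E _ s01') (fF _ s01'); ring.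
  have Hd : is_derive t 1 (fun s => G s + (F 0 - L * s)) (g0 t - L).
    have dG : is_derive t 1 G (g0 t).
      by clearbody G; rewrite -d2 derive1E; exact: DeriveDef.
    have -> : (fun s => G s + (F 0 - L * s)) = G + (cst (F 0) - L \*: id).
      by apply/funext.
    apply: is_deriveD; rewrite -[X in is_derive _ _ _ X]add0r.
    apply: is_deriveB; rewrite -[X in is_derive _ _ _ X]mulr1.
    exact: is_deriveZ.
  have : is_derive t 1 f (g0 t - L).
    by apply: near_eq_is_derive Hd.
  by move=> [fd <-]; split; [exact: fd|rewrite derive1E].
- have e01 : f 1 - f 0 = (\int[mu]_(t in `]0, 1]) g0 t)%R - L.
    rewrite -g0E; last lra.
    by rewrite !fF; lra.
  rewrite e01 RintegralB//; first last.
  + exact: integrable_cst_itv01.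
  + exact: g0itv.
  have mu01 : mu `[0%R, 1%R]%classic = 1%E.
    by rewrite lebesgue_measure_itv/= lte_fin ltr01 oppr0 adde0.
  rewrite Rintegral_cst// -[X in _ * X]/(fine (mu `[0, 1]%classic)) mu01 mulr1.
  by rewrite Rintegral_itv_obnd_cbnd//; apply: integrableS g0int.
Unshelve. all: by end_near. Qed.

End LipschitzFTC.

(** * The Euclidean inner product and norm *)

Section Euclidean.
Context {R : realType} {N : nat}.
Implicit Types x y z nu : 'rV[R]_N.

Lemma dotC x y : dot x y = dot y x.
Proof. by apply: eq_bigr => i _; rewrite mulrC. Qed.

Lemma dotDl x y z : dot (x + y) z = dot x z + dot y z.
Proof. by rewrite -big_split; apply: eq_bigr => i _; rewrite mxE mulrDl. Qed.

Lemma dotZl k x y : dot (k *: x) y = k * dot x y.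
Proof. by rewrite /dot mulr_sumr; apply: eq_bigr => i _; rewrite mxE mulrA. Qed.

Lemma dotNl x y : dot (- x) y = - dot x y.
Proof. by rewrite -scaleN1r dotZl mulN1r. Qed.

Lemma dotBl x y z : dot (x - y) z = dot x z - dot y z.
Proof. by rewrite dotDl dotNl. Qed.

Lemma dotNr x y : dot x (- y) = - dot x y.
Proof. by rewrite dotC dotNl dotC. Qed.

Lemma dot_ge0 x : 0 <= dot x x.
Proof. by apply: sumr_ge0 => i _; rewrite -expr2 sqr_ge0. Qed.

Lemma enorm_ge0 x : 0 <= enorm x.
Proof. exact: sqrtr_ge0. Qed.

Lemma enormZ k x : enorm (k *: x) = `|k| * enorm x.
Proof.
rewrite /enorm dotZl dotC dotZl mulrA -expr2 sqrtrM ?sqr_ge0//.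
by rewrite sqrtr_sqr.
Qed.

Lemma enormN x : enorm (- x) = enorm x.
Proof. by rewrite -scaleN1r enormZ normrN1 mul1r. Qed.

Lemma dot_unit nu : enorm nu = 1 -> dot nu nu = 1.
Proof. by move=> /(congr1 (fun r => r ^+ 2)); rewrite sqr_sqrtr ?dot_ge0// expr1n. Qed.

(** Cauchy-Schwarz against a unit vector: the squared norm of the component of [x] orthogonal to
    [nu] is nonnegative. *)
Lemma dot_le_enorm x nu : enorm nu = 1 -> `|dot x nu| <= enorm x.
Proof.
move=> nu1; rewrite -sqrtr_sqr ler_wsqrtr//.
have := dot_ge0 (x - dot x nu *: nu).
rewrite dotBl dotZl ![dot _ (x - _)]dotC !dotBl !dotZl (dot_unit nu1) (dotC nu x).
lra.
Qed.

Lemma coord_le_norm x i : `|x ord0 i| <= `|x|.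
Proof.
by rewrite [leRHS]/Num.Def.normr/= mx_normrE; apply: (le_bigmax _ _ (ord0, i)).
Qed.

Lemma enorm_le_coord x r : 0 <= r -> (forall i, `|x ord0 i| <= r) ->
  enorm x <= Num.sqrt N%:R * r.
Proof.
move=> r0 xr; rewrite -[X in _ * X](ger0_norm r0) -sqrtr_sqr -sqrtrM ?ler0n//.
rewrite ler_wsqrtr// mulr_natl -[X in _ *+ X]card_ord -sumr_const.
apply: ler_sum => i _; rewrite -expr2 -real_normK ?num_real//.
by rewrite ler_sqr ?nnegrE.
Qed.

End Euclidean.

(** * Almost everywhere derivatives of Lipschitz curves *)

Section LipschitzCurves.
Context {R : realType} {N : nat}.
Implicit Types gamma : R -> 'rV[R]_N.
Notation mu := (@lebesgue_measure R).

(** The Lipschitz predicate asks for the bound with all large enough constants; the estimates below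
    use a single one. *)
Lemma lipschitz_itv01P gamma : [lipschitz gamma t | t in `[0, 1]] <->
  exists M : R, forall x y, 0 <= x <= 1 -> 0 <= y <= 1 ->
    `|gamma x - gamma y| <= M * `|x - y|.
Proof.
split=> [[M [Mr HM]]|[M HM]].
  exists (M + 1) => x y x01 y01.
  by apply: (HM (M + 1) _ (x, y)); [rewrite ltrDl|split; rewrite /= in_itv].
exists M; split; first exact: num_real.
move=> k Mk [x y] [/= x01 y01]; rewrite !in_itv/= in x01 y01.
by apply: (le_trans (HM _ _ x01 y01)); rewrite ler_wpM2r// ltW.
Qed.

(** The two end points form a null set. Derivatives are controlled only in the open interval, while
    lengths integrate over the closed one. *)
Lemma ae_itvoo_itvcc (P : R -> Prop) (a b : R) :
  {ae mu, forall t, `]a, b[%classic t -> P t} ->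
  {ae mu, forall t, `[a, b]%classic t -> P t}.
Proof.
move=> Poo.
have Pa : {ae mu, forall t, t <> a}.
  by exists [set a]; split => //; [exact: lebesgue_measure_set1|
    move=> t /= /contrapT].
have Pb : {ae mu, forall t, t <> b}.
  by exists [set b]; split => //; [exact: lebesgue_measure_set1|
    move=> t /= /contrapT].
have aeF := ae_filter_ringOfSetsType mu.
apply: filterS3 Poo Pa Pb => t Poo ta tb; rewrite /= in_itv/= => /andP[a_t t_b].
by apply: Poo; rewrite /= in_itv/= !lt_neqAle a_t t_b !andbT eq_sym; apply/andP; split; apply/eqP.
Qed.

(** The scalar result is applied to each coordinate; the finitely many exceptional sets have a null
    union. *)
Lemma lipschitz_curve_density gamma : [lipschitz gamma t | t in `[0, 1]] ->
  exists g : R -> 'rV[R]_N, [/\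
    forall i, measurable_fun setT (fun t => g t ord0 i),
    forall i, mu.-integrable `[0, 1] (EFin \o (fun t => g t ord0 i)),
    {ae mu, forall t, `[0, 1]%classic t ->
       derivable gamma t 1 /\ derive1 gamma t = g t} &
    forall i, gamma 1 ord0 i - gamma 0 ord0 i =
      (\int[mu]_(t in `[0, 1]) g t ord0 i)%R].
Proof.
move=> /lipschitz_itv01P[M HM].
have H i := @lipschitz_density R (fun t => gamma t ord0 i) M.
have /choice[g Hg] : forall i, exists g : R -> R, [/\ measurable_fun setT g,
    mu.-integrable `[0, 1] (EFin \o g),
    {ae mu, forall t, `]0, 1[%classic t -> derivable (fun t => gamma t ord0 i) t 1 /\
       derive1 (fun t => gamma t ord0 i) t = g t} &
    gamma 1 ord0 i - gamma 0 ord0 i = (\int[mu]_(t in `[0, 1]) g t)%R].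
  move=> i; apply: lipschitz_density (M) _ => x y x01 y01.
  apply: le_trans (HM _ _ x01 y01).
  by have := coord_le_norm (gamma x - gamma y) i; rewrite !mxE.
exists (fun t => \row_i g i t); split.
- move=> i; have [+ _ _ _] := Hg i.
  by congr (measurable_fun _ _); apply/funext => t; rewrite mxE.
- move=> i; have [_ + _ _] := Hg i.
  by congr (mu.-integrable _ _); apply/funext => t; rewrite /= mxE.
- apply: ae_itvoo_itvcc.
  have aeF := ae_filter_ringOfSetsType mu.
  have : {ae mu, forall t i, `]0, 1[%classic t ->
      derivable (fun t => gamma t ord0 i) t 1 /\
      derive1 (fun t => gamma t ord0 i) t = g i t}.
    apply: filter_forall => i.
    by have [_ _ + _] := Hg i.
  apply: filterS => t Ht t01.
  have dg : derivable gamma t 1.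
    by apply/derivable_mxP => i j; rewrite ord1; have [] := Ht j t01.
  split=> //; rewrite derive1E derive_mx//; apply/matrixP => i j.
  by rewrite ord1 !mxE -derive1E; have [] := Ht j t01.
- move=> i; have [_ _ _ ->] := Hg i.
  by apply: eq_Rintegral => t _; rewrite mxE.
Qed.

End LipschitzCurves.

(** * Measurability and lower bound of the weighted length *)

Section WeightedLength.
Context {R : realType} {N : nat}.
Implicit Types (gamma : R -> 'rV[R]_N) (x y z nu : 'rV[R]_N).
Notation mu := (@lebesgue_measure R).
Variables (a : 'rV[R]_N -> R) (theta Theta : R).
Hypothesis ca : continuous a.
Hypothesis abnd : forall x, theta <= a x <= Theta.

Definition speed gamma t := Num.sqrt (a (gamma t)) * enorm (derive1 gamma t).

Lemma speed_ge0 gamma t : 0 <= speed gamma t.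
Proof. by rewrite mulr_ge0 ?sqrtr_ge0 ?enorm_ge0. Qed.

Lemma weighted_length_ge0 gamma : (0 <= weighted_length a gamma)%E.
Proof. by apply: integral_ge0 => t _; rewrite lee_fin speed_ge0. Qed.

Lemma sqrt_weight_bounds x : Num.sqrt theta <= Num.sqrt (a x) <= Num.sqrt Theta.
Proof. by have /andP[h1 h2] := abnd x; rewrite !ler_wsqrtr. Qed.

Lemma clamp_curve_continuous gamma : [lipschitz gamma t | t in `[0, 1]] ->
  continuous (gamma \o @clamp R).
Proof.
move=> /lipschitz_itv01P[M HM] x.
apply/cvgrPdist_lt => e e0; near=> y.
apply: (@le_lt_trans _ _ ((`|M| + 1) * `|x - y|)).
  rewrite (le_trans (HM _ _ (clamp_itv _) (clamp_itv _)))//.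
  apply: (@le_trans _ _ ((`|M| + 1) * `|clamp x - clamp y|)).
    rewrite ler_wpM2r//.
    by rewrite (le_trans (ler_norm M))// lerDl.
  rewrite ler_wpM2l//.
  have [xy|/ltW xy] := leP x y.
    have := clamp_nondecreasing xy; rewrite distrC (distrC x) => /andP[h1 h2].
    by rewrite !ger0_norm// subr_ge0.
  have := clamp_nondecreasing xy => /andP[h1 h2].
  by rewrite !ger0_norm// subr_ge0.
rewrite mulrC -ltr_pdivlMr ?ltr_wpDl//.
by near: y; apply: cvgr_dist_lt => //; rewrite divr_gt0// ltr_wpDl.
Unshelve. all: by end_near. Qed.

Lemma measurable_enorm (g : R -> 'rV[R]_N) :
  (forall i, measurable_fun setT (fun t => g t ord0 i)) ->
  measurable_fun setT (fun t => enorm (g t)).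
Proof.
move=> mg; apply: measurableT_comp.
  apply: continuous_measurable_fun; exact: sqrt_continuous.
by apply: measurable_sum => i; apply: measurable_funM; exact: mg.
Qed.

(** The integrand of the length has no control where [gamma] is not derivable. [W] is an everywhere
    measurable substitute that agrees with it almost everywhere on the interval, so substitutions
    and additivity apply to [W]. *)
Lemma measurable_speed gamma : [lipschitz gamma t | t in `[0, 1]] ->
  exists W : R -> R, [/\ measurable_fun setT W, forall t, 0 <= W t,
    {ae mu, forall t, `[0, 1]%classic t ->
       derivable gamma t 1 /\ speed gamma t = W t} &
    weighted_length a gamma = (\int[mu]_(t in `[0%R, 1%R]) (W t)%:E)%E].
Proof.
move=> lg; have [g [mg _ gder _]] := lipschitz_curve_density lg.
(* A curve is arbitrary outside the unit interval; clamping the time makes the weight factor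
   continuous on the whole line. *)
pose W t := Num.sqrt (a (gamma (clamp t))) * enorm (g t).
have W0 t : 0 <= W t by rewrite mulr_ge0 ?sqrtr_ge0 ?enorm_ge0.
have mW : measurable_fun setT W.
  apply: measurable_funM; last exact: measurable_enorm.
  apply: continuous_measurable_fun => t.
  apply: (@continuous_comp _ _ _ (fun t => a (gamma (clamp t)))); last exact: sqrt_continuous.
  apply: (@continuous_comp _ _ _ (gamma \o @clamp R)); last exact: ca.
  exact: clamp_curve_continuous.
have aeW : {ae mu, forall t, `[0, 1]%classic t ->
       derivable gamma t 1 /\ speed gamma t = W t}.
  have aeF := ae_filter_ringOfSetsType mu.
  apply: filterS gder => t h /[dup] t01 /h[dg Hg]; split=> //.
  by rewrite /W /speed Hg clamp_id//; move: t01; rewrite /= in_itv.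
exists W; split => //.
apply: ge0_ae_eq_integral_nonmeasurable => //.
- by apply/measurable_EFinP; exact: measurable_funTS.
- by move=> t _; rewrite lee_fin speed_ge0.
- by move=> t _; rewrite lee_fin.
- have aeF := ae_filter_ringOfSetsType mu.
  by apply: filterS aeW => t h /h [_ ht]; congr EFin.
Qed.

(** The displacement along [nu] is the integral of the [nu]-component of the velocity, whose
    absolute value is at most the Euclidean speed, and the weight is at least [Num.sqrt theta]. *)
Lemma weighted_length_lower gamma nu : [lipschitz gamma t | t in `[0, 1]] ->
  enorm nu = 1 ->
  ((Num.sqrt theta * `|dot (gamma 1 - gamma 0) nu|)%:E <= weighted_length a gamma)%E.
Proof.
move=> lg nu1; have [g [mg ig gder gE]] := lipschitz_curve_density lg.
pose h t := dot (g t) nu.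
have mh : measurable_fun setT h.
  by apply: measurable_sum => i; apply: measurable_funM => //; exact: mg.
have iE t : (h t)%:E = (\sum_i (nu ord0 i)%:E * (g t ord0 i)%:E)%E.
  by rewrite sumEFin; congr EFin; apply: eq_bigr => i _; rewrite mulrC.
have ih : mu.-integrable `[0, 1] (EFin \o h).
  have -> : EFin \o h = (fun t => \sum_i (nu ord0 i)%:E * (g t ord0 i)%:E)%E.
    by apply/funext.
  by apply: integrable_sum => // i _; apply: integrableZl => //; exact: ig.
have hE : (\int[mu]_(t in `[0%R, 1%R]) (h t)%:E)%E = (dot (gamma 1 - gamma 0) nu)%:E.
  under eq_integral do rewrite iE.
  rewrite integral_sum//; last first.
    by move=> i; apply: integrableZl => //; exact: ig.
  rewrite /dot -sumEFin; apply: eq_bigr => i _.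
  rewrite integralZl//; last exact: ig.
  rewrite !mxE gE mulrC EFinM /Rintegral fineK//.
  by apply: integrable_fin_num => //; exact: ig.
rewrite EFinM -[X in (_ * X)%E]/(`|(dot (gamma 1 - gamma 0) nu)%:E|)%E -hE.
apply: (@le_trans _ _ (\int[mu]_(t in `[0%R, 1%R])
    ((Num.sqrt theta)%:E * `|(h t)%:E|))%E).
  rewrite ge0_integralZl//; last first.
  - by apply: measurableT_comp => //; apply/measurable_EFinP; exact: measurable_funTS.
  - apply: lee_wpmul2l; first by rewrite lee_fin sqrtr_ge0.
    by apply: le_abse_integral => //; apply/measurable_EFinP; exact: measurable_funTS.
apply: measurable_ae_le_integral => //.
- apply: measurable_funeM; apply: measurableT_comp => //.
  by apply/measurable_EFinP; exact: measurable_funTS.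
- by move=> t _; rewrite lee_fin speed_ge0.
have aeF := ae_filter_ringOfSetsType mu.
apply: filterS gder => t H /H[_ Ht].
rewrite -EFinM lee_fin; apply: ler_pM => //.
  by have /andP[] := sqrt_weight_bounds (gamma t).
by rewrite Ht; exact: dot_le_enorm.
Qed.

End WeightedLength.

(** * Reversal and concatenation of curves *)

Section CurveOperations.
Context {R : realType} {N : nat}.
Implicit Types (gamma delta : R -> 'rV[R]_N) (x y z nu : 'rV[R]_N).
Notation mu := (@lebesgue_measure R).
Variables (a : 'rV[R]_N -> R).

Lemma is_derive_affine (f : R -> R) (k b t : R) :
  derivable f (k * t + b) 1 ->
  is_derive t 1 (fun s => f (k * s + b)) (k * derive1 f (k * t + b)).
Proof.
move=> df.
have dphi : is_derive t 1 (fun s : R => k * s + b) k.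
  have -> : (fun s : R => k * s + b) = (k \*: id) + cst b by apply/funext.
  rewrite -[X in is_derive _ _ _ X]addr0; apply: is_deriveD.
  by rewrite -[X in is_derive _ _ _ X]mulr1; exact: is_deriveZ.
rewrite mulrC derive1E.
by apply: (@is_derive1_comp _ f (fun s => k * s + b)); exact: DeriveDef.
Qed.

(** The chain rule, coordinate by coordinate. Agreement near [t] is enough since a derivative is
    local; this covers curves defined piecewise. *)
Lemma speed_affine gamma delta (k b t : R) :
  derivable gamma (k * t + b) 1 ->
  (\forall s \near t, delta s = gamma (k * s + b)) ->
  speed a delta t = `|k| * speed a gamma (k * t + b).
Proof.
move=> dg near_eq.
pose eta s := gamma (k * s + b).
have eta_i i : is_derive t 1 (fun s => eta s ord0 i)
    (k * derive1 (fun s => gamma s ord0 i) (k * t + b)).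
  by apply: (@is_derive_affine (fun s => gamma s ord0 i)); move/derivable_mxP : dg; exact.
have deta : derivable eta t 1.
  by apply/derivable_mxP => i j; rewrite ord1; have [] := eta_i j.
have -> : speed a delta t = speed a eta t.
  rewrite /speed !derive1E.
  have -> : 'D_1 delta t = 'D_1 eta t by exact: near_eq_derive.
  by have -> : delta t = eta t := nbhs_singleton near_eq.
rewrite /speed mulrCA -enormZ; congr (_ * enorm _).
rewrite (derive1E eta) (derive1E gamma) (derive_mx deta) (derive_mx dg).
apply/matrixP => i j; rewrite ord1 !mxE; have [_ ->] := eta_i j.
by rewrite derive1E.
Qed.

(** The bad times of [delta] lie in the affine preimage of the bad times of [gamma], which is null.
    The interval is open so that the two curves agree near each of its points. *)
Lemma ae_speed_affine gamma delta (W : R -> R) (k b p q : R) : k != 0 ->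
  (forall t, p < t < q -> delta t = gamma (k * t + b)) ->
  (forall t, p < t < q -> 0 <= k * t + b <= 1) ->
  {ae mu, forall t, `[0, 1]%classic t ->
     derivable gamma t 1 /\ speed a gamma t = W t} ->
  {ae mu, forall t, `]p, q[%classic t ->
     speed a delta t = `|k| * W (k * t + b)}.
Proof.
move=> k0 dE kb01 aeW; have := negligible_affine b k0 aeW.
apply: negligibleS => t /= /not_implyP[]; rewrite in_itv/= => tpq h hW.
apply: h; have [|dg <-] := hW; first by rewrite /= in_itv/= kb01.
apply: speed_affine => //; near=> s; apply: dE.
have : s \in `]p, q[ by near: s; apply: near_in_itvoo; rewrite in_itv.
by rewrite in_itv.
Unshelve. all: by end_near. Qed.

Hypothesis ca : continuous a.

(** The time change is spelled in the form [k * t + b] to match the affine lemmas. *)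
Definition reverse_curve gamma : R -> 'rV[R]_N := fun t => gamma (-1 * t + 1).

Lemma reverse_lipschitz_curve gamma y z : lipschitz_curve y z gamma ->
  lipschitz_curve z y (reverse_curve gamma).
Proof.
move=> [/lipschitz_itv01P[M HM] g0 g1]; split.
- apply/lipschitz_itv01P; exists M => s t s01 t01.
  rewrite (le_trans (HM _ _ _ _))//; try lra.
  by rewrite opprD addrACA subrr addr0 !mulN1r opprK addrC distrC.
- by rewrite /reverse_curve mulr0 add0r.
- by rewrite /reverse_curve mulr1 addNr.
Qed.

(** Substitution of [1 - t] for [t]. An inequality suffices, since symmetry of the distance follows
    by applying it in both directions. *)
Lemma weighted_length_reverse gamma : [lipschitz gamma t | t in `[0, 1]] ->
  (weighted_length a (reverse_curve gamma) <= weighted_length a gamma)%E.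
Proof.
move=> lg; have [W [mW W0 aeW ->]] := measurable_speed ca lg.
have n1 : -1 != 0 :> R by rewrite oppr_eq0 oner_eq0.
have mW' := measurable_affine (-1) (1 : R).
rewrite [leRHS](@ge0_integral_affine _ (-1) 1)//; last 2 first.
- by apply/measurable_EFinP; exact: measurable_funTS.
- by move=> x _; rewrite lee_fin.
rewrite normrN1 mul1e.
have -> : (fun t : R => -1 * t + 1) @^-1` `[0%R, 1%R]%classic = `[0%R, 1%R]%classic.
  by apply/seteqP; split=> t /=; rewrite !in_itv/= => ?; lra.
apply: integral_le_measurable_ae => //.
- by apply/measurable_EFinP; apply: measurable_funTS; exact: measurableT_comp.
- by move=> t _; rewrite lee_fin speed_ge0.
- by move=> t _; rewrite lee_fin.
- apply: ae_itvoo_itvcc.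
  have := @ae_speed_affine gamma (reverse_curve gamma) W (-1) 1 0 1 n1
    (fun t _ => erefl) _ aeW.
  have aeF := ae_filter_ringOfSetsType mu.
  move=> H; have {}H := H ltac:(by move=> t t01; lra).
  by apply: filterS H => t h /h ht; rewrite lee_fin -[leLHS]/(speed _ _ _) ht normrN1 mul1r.
Qed.

Definition concat_curve gamma delta : R -> 'rV[R]_N :=
  fun t => if t <= 2^-1 then gamma (2 * t + 0) else delta (2 * t + -1).

Lemma concat_lipschitz_curve gamma delta x y z :
  lipschitz_curve x y gamma -> lipschitz_curve y z delta ->
  lipschitz_curve x z (concat_curve gamma delta).
Proof.
move=> [/lipschitz_itv01P[M1 HM1] g0 g1] [/lipschitz_itv01P[M2 HM2] d0 d1].
split.
(* The factor 2 comes from running each curve at double speed; the sum of absolute values dominates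
   both constants. *)
- apply/lipschitz_itv01P; exists (2 * (`|M1| + `|M2|)).
  have H1 s t : 0 <= s -> s <= t -> t <= 2^-1 ->
      `|gamma (2 * s + 0) - gamma (2 * t + 0)| <= 2 * (`|M1| + `|M2|) * (t - s).
    move=> s0 st t2; rewrite (le_trans (HM1 _ _ _ _))//; try lra.
    have -> : `|2 * s + 0 - (2 * t + 0)| = 2 * (t - s).
      by rewrite distrC ger0_norm; lra.
    rewrite mulrCA -mulrA ler_wpM2l// ler_wpM2r ?subr_ge0//.
    by rewrite (le_trans (ler_norm M1))// lerDl.
  have H2 s t : 2^-1 <= s -> s <= t -> t <= 1 ->
      `|delta (2 * s + -1) - delta (2 * t + -1)| <= 2 * (`|M1| + `|M2|) * (t - s).
    move=> s0 st t2; rewrite (le_trans (HM2 _ _ _ _))//; try lra.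
    have -> : `|2 * s + -1 - (2 * t + -1)| = 2 * (t - s).
      by rewrite distrC ger0_norm; lra.
    rewrite mulrCA -mulrA ler_wpM2l// ler_wpM2r ?subr_ge0//.
    by rewrite (le_trans (ler_norm M2))// lerDr.
  have H s t : 0 <= s -> s <= t -> t <= 1 ->
      `|concat_curve gamma delta s - concat_curve gamma delta t| <=
      2 * (`|M1| + `|M2|) * (t - s).
    move=> s0 st t1; rewrite /concat_curve.
    have [s2|s2] := leP s 2^-1; have [t2|t2] := leP t 2^-1.
    + exact: H1.
    (* Two times on opposite sides of the junction are compared through it, where both curves are at
       [y]. *)
    + have -> : t - s = (2^-1 - s) + (t - 2^-1) by lra.
      rewrite mulrDr; apply: le_trans (lerD (H1 _ _ s0 s2 (lexx _)) (H2 _ _ (lexx _) (ltW t2) t1)).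
      have -> : 2 * 2^-1 + 0 = 1 :> R by lra.
      have -> : 2 * 2^-1 + -1 = 0 :> R by lra.
      by rewrite g1 d0; exact: ler_distD.
    + by lra.
    + by apply: H2 => //; exact: ltW.
  move=> s t /andP[s0 s1] /andP[t0 t1].
  have [st|/ltW ts] := leP s t.
    by rewrite (distrC s) (ger0_norm (_ : 0 <= t - s)) ?subr_ge0//; exact: H.
  by rewrite distrC (ger0_norm (_ : 0 <= s - t)) ?subr_ge0//; exact: H.
- by rewrite /concat_curve mulr0 addr0 invr_ge0 ler0n.
- rewrite /concat_curve ifF; first by rewrite -d1; congr delta; lra.
  by apply/negbTE; rewrite -ltNge; lra.
Qed.

(** Each half of the time interval carries the length of one curve, by the substitutions [2 * t] and
    [2 * t - 1]. *)
Lemma weighted_length_concat gamma delta :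
  [lipschitz gamma t | t in `[0, 1]] -> [lipschitz delta t | t in `[0, 1]] ->
  (weighted_length a (concat_curve gamma delta) <=
   weighted_length a gamma + weighted_length a delta)%E.
Proof.
move=> lg ld.
have [W1 [mW1 W10 aeW1 ->]] := measurable_speed ca lg.
have [W2 [mW2 W20 aeW2 ->]] := measurable_speed ca ld.
have n2 : 2 != 0 :> R by rewrite pnatr_eq0.
pose w1 t := 2 * W1 (2 * t + 0).
pose w2 (t : R) := 2 * W2 (2 * t + -1).
have mw1 : measurable_fun setT w1.
  apply: measurable_funM => //.
  exact: (measurableT_comp mW1 (measurable_affine 2 0)).
have mw2 : measurable_fun setT w2.
  apply: measurable_funM => //.
  exact: (measurableT_comp mW2 (measurable_affine 2 (-1))).
have I1 : (\int[mu]_(t in `[0%R, (2^-1)%R]) (w1 t)%:E = \int[mu]_(t in `[0%R, 1%R]) (W1 t)%:E)%E.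
  rewrite [RHS](@ge0_integral_affine _ 2 0)//; last 2 first.
  - by apply/measurable_EFinP; exact: measurable_funTS.
  - by move=> x _; rewrite lee_fin.
  have -> : (fun t : R => (2 * t + 0)%R) @^-1` `[0%R, 1%R]%classic = `[0%R, (2^-1)%R]%classic.
    by apply/seteqP; split=> t /=; rewrite !in_itv/= => ?; lra.
  rewrite -ge0_integralZl//; last first.
  - by move=> t _; rewrite lee_fin.
  - apply/measurable_EFinP; apply: measurable_funTS.
    exact: (measurableT_comp mW1 (measurable_affine 2 0)).
  by apply: eq_integral => t _; rewrite -EFinM ger0_norm.
(* The second half omits its left end point to be disjoint from the first; the missing point of [W2]
   is restored at the end by monotonicity in the domain. *)
have I2 : (\int[mu]_(t in `](2^-1)%R, 1%R]) (w2 t)%:E = \int[mu]_(t in `]0%R, 1%R]) (W2 t)%:E)%E.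
  rewrite [RHS](@ge0_integral_affine _ 2 (-1))//; last 2 first.
  - by apply/measurable_EFinP; exact: measurable_funTS.
  - by move=> x _; rewrite lee_fin.
  have -> : (fun t : R => (2 * t + -1)%R) @^-1` `]0%R, 1%R]%classic = `](2^-1)%R, 1%R]%classic.
    by apply/seteqP; split=> t /=; rewrite !in_itv/= => ?; lra.
  rewrite -ge0_integralZl//; last first.
  - by move=> t _; rewrite lee_fin.
  - apply/measurable_EFinP; apply: measurable_funTS.
    exact: (measurableT_comp mW2 (measurable_affine 2 (-1))).
  by apply: eq_integral => t _; rewrite -EFinM ger0_norm.
pose w t := if t <= 2^-1 then w1 t else w2 t.
have mw : measurable_fun setT w.
  apply: measurable_fun_ifT => //.
  exact: measurable_fun_ler.
have w0 t : 0 <= w t.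
  by rewrite /w; case: ifP => _; rewrite mulr_ge0.
apply: (@le_trans _ _ (\int[mu]_(t in `[0%R, 1%R]) (w t)%:E)%E).
  apply: integral_le_measurable_ae => //.
  - by apply/measurable_EFinP; exact: measurable_funTS.
  - by move=> t _; rewrite lee_fin speed_ge0.
  - by move=> t _; rewrite lee_fin.
  have aeF := ae_filter_ringOfSetsType mu.
  have A1 : {ae mu, forall t, `]0, 2^-1[%classic t ->
      speed a (concat_curve gamma delta) t = `|2| * W1 (2 * t + 0)}.
    apply: ae_speed_affine aeW1 => // t /andP[t0 t1]; last lra.
    by rewrite /concat_curve ifT// ltW.
  have A2 : {ae mu, forall t, `]2^-1, 1[%classic t ->
      speed a (concat_curve gamma delta) t = `|2| * W2 (2 * t + -1)}.
    apply: ae_speed_affine aeW2 => // t /andP[t0 t1]; last lra.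
    by rewrite /concat_curve ifF//; apply/negbTE; rewrite -ltNge.
  have {}A1 := ae_itvoo_itvcc A1.
  have {}A2 : {ae mu, forall t, `]2^-1, 1]%classic t ->
      speed a (concat_curve gamma delta) t = `|2| * W2 (2 * t + -1)}.
    apply: filterS (ae_itvoo_itvcc A2) => t h /=; rewrite in_itv/= => /andP[t1 t2].
    by apply: h; rewrite /= in_itv/= ltW.
  apply: filterS2 A1 A2 => t h1 h2 /=; rewrite in_itv/= => /andP[t0 t1].
  rewrite lee_fin /w -[leLHS]/(speed _ _ _); case: (leP t 2^-1) => t2.
    by rewrite h1 ?ger0_norm// /= in_itv/= t0.
  by rewrite h2 ?ger0_norm// /= in_itv/= t2.
have itvE : `[0%R, 1%R]%classic = `[0%R, (2^-1)%R]%classic `|` `](2^-1)%R, 1%R]%classic :> set R.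
  by apply/seteqP; split=> t /=; rewrite !in_itv/=;
   [move=> ?; have [?|?] := leP t 2^-1; [left|right]; lra|move=> [?|?]; lra].
rewrite [in leLHS]itvE ge0_integral_setU//; last 3 first.
- by apply/measurable_EFinP; exact: measurable_funTS.
- by move=> t _; rewrite lee_fin.
- apply/disj_setPLR => t /=; rewrite !in_itv/= => /andP[_ h].
  by apply/negP; rewrite negb_and -leNgt h.
apply: leeD.
  rewrite -I1 le_eqVlt; apply/orP; left; apply/eqP; apply: eq_integral => t.
  by rewrite inE/= in_itv/= /w => /andP[_ ->].
have -> : (\int[mu]_(t in `](2^-1)%R, 1%R]) (w t)%:E = \int[mu]_(t in `](2^-1)%R, 1%R]) (w2 t)%:E)%E.
  apply: eq_integral => t.
  by rewrite inE/= in_itv/= /w => /andP[h _]; rewrite ifF//; apply/negbTE; rewrite -ltNge.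
rewrite I2; apply: ge0_subset_integral => //.
- by apply/measurable_EFinP; exact: measurable_funTS.
- by move=> t _; rewrite lee_fin.
- by move=> t /=; rewrite !in_itv/= => /andP[/ltW-> ->].
Qed.

End CurveOperations.

(** * The weighted distance as a finite metric comparable to the Euclidean one *)

Section WeightedDistance.
Context {R : realType} {N : nat}.
Implicit Types (gamma delta : R -> 'rV[R]_N) (x y z nu : 'rV[R]_N).
Notation mu := (@lebesgue_measure R).
Variables (a : 'rV[R]_N -> R) (theta Theta : R).
Hypothesis ca : continuous a.
Hypothesis abnd : forall x, theta <= a x <= Theta.

Definition segment_curve y z : R -> 'rV[R]_N := fun t => y + t *: (z - y).

Lemma segment_lipschitz_curve y z : lipschitz_curve y z (segment_curve y z).
Proof.
split; last 2 first.
- by rewrite /segment_curve scale0r addr0.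
- by rewrite /segment_curve scale1r subrKC.
apply/lipschitz_itv01P; exists `|z - y| => s t _ _.
rewrite /segment_curve opprD addrACA subrr add0r -scalerBl normrZ.
by rewrite mulrC.
Qed.

Lemma derive1_segment y z t : derive1 (segment_curve y z) t = z - y.
Proof.
have di i j : is_derive t 1 (fun s => segment_curve y z s i j) ((z - y) i j).
  have -> : (fun s => segment_curve y z s i j) = cst (y i j) + (z - y) i j \*: id.
    by apply/funext => s; rewrite !fctE !mxE mulrC.
  rewrite -[X in is_derive _ _ _ X]add0r; apply: is_deriveD.
  by rewrite -[X in is_derive _ _ _ X]mulr1; exact: is_deriveZ.
have ds : derivable (segment_curve y z) t 1.
  by apply/derivable_mxP => i j; have [] := di i j.
rewrite derive1E derive_mx//; apply/matrixP => i j; rewrite mxE.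
by have [_ ->] := di i j.
Qed.

Lemma weighted_length_segment y z :
  (weighted_length a (segment_curve y z) <= (Num.sqrt Theta * enorm (z - y))%:E)%E.
Proof.
have <- : (\int[mu]_(t in `[0%R, 1%R]) (Num.sqrt Theta * enorm (z - y))%:E =
   (Num.sqrt Theta * enorm (z - y))%:E)%E.
  have mu01 : mu `[0%R, 1%R]%classic = 1%E.
    by rewrite lebesgue_measure_itv/= lte_fin ltr01 oppr0 adde0.
  by rewrite integral_cst// -[X in (_ * X)%E]/(mu `[0%R, 1%R]%classic) mu01 mule1.
apply: ge0_le_integral_nonmeasurable => t _.
  by rewrite lee_fin speed_ge0.
rewrite derive1_segment lee_fin ler_wpM2r ?enorm_ge0//.
by have /andP[] := sqrt_weight_bounds abnd (segment_curve y z t).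
Qed.

Definition dist y z : R := fine (dist_sqrt a y z).

Lemma dist_sqrt_le y z gamma : lipschitz_curve y z gamma ->
  (dist_sqrt a y z <= weighted_length a gamma)%E.
Proof. by move=> lg; apply: ereal_inf_lbound; exists gamma. Qed.

Lemma dist_sqrt_ge0 y z : (0 <= dist_sqrt a y z)%E.
Proof. by apply: le_ereal_inf_tmp => _ [gamma _ <-]; exact: weighted_length_ge0. Qed.

(** The straight segment has finite weighted length, so passing to a real number loses nothing. *)
Lemma distE y z : dist_sqrt a y z = (dist y z)%:E.
Proof.
rewrite fineK// ge0_fin_numE ?dist_sqrt_ge0//.
apply: le_lt_trans (ltry (Num.sqrt Theta * enorm (z - y))).
apply: le_trans (weighted_length_segment y z).
exact/dist_sqrt_le/segment_lipschitz_curve.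
Qed.

Lemma dist_ge0 y z : 0 <= dist y z.
Proof. by rewrite -lee_fin -distE dist_sqrt_ge0. Qed.

Lemma dist_le_enorm y z : dist y z <= Num.sqrt Theta * enorm (z - y).
Proof.
rewrite -lee_fin -distE; apply: le_trans (weighted_length_segment y z).
exact/dist_sqrt_le/segment_lipschitz_curve.
Qed.

Lemma dist_ge_dot y z nu : enorm nu = 1 ->
  Num.sqrt theta * `|dot (z - y) nu| <= dist y z.
Proof.
move=> nu1; rewrite -lee_fin -distE; apply: le_ereal_inf_tmp => _ [gamma [lg <- <-] <-].
exact: (weighted_length_lower abnd).
Qed.

Lemma dist_approx y z e : 0 < e -> exists2 gamma, lipschitz_curve y z gamma &
  (weighted_length a gamma <= (dist y z + e)%:E)%E.
Proof.
move=> e0; have : (dist_sqrt a y z < (dist y z + e)%:E)%E.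
  by rewrite distE lte_fin ltrDl.
by move=> /ereal_inf_lt[_ [gamma lg <-] /ltW ?]; exists gamma.
Qed.

Lemma dist_sym_le y z : dist z y <= dist y z.
Proof.
apply/ler_addgt0Pr => e /dist_approx-/(_ y z)[gamma lg le].
rewrite -lee_fin -distE; apply: le_trans le.
have [lip _ _] := lg.
apply: le_trans (weighted_length_reverse ca lip).
exact/dist_sqrt_le/reverse_lipschitz_curve.
Qed.

Lemma dist_sym y z : dist y z = dist z y.
Proof. by apply/eqP; rewrite eq_le !dist_sym_le. Qed.

Lemma dist_triangle y x z : dist x z <= dist x y + dist y z.
Proof.
apply/ler_addgt0Pr => e e0; have e2 : 0 < e / 2 by rewrite divr_gt0.
have [g1 lg1 le1] := dist_approx x y e2.
have [g2 lg2 le2] := dist_approx y z e2.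
have -> : dist x y + dist y z + e = (dist x y + e / 2) + (dist y z + e / 2) by field.
rewrite -lee_fin -distE EFinD; apply: le_trans (leeD le1 le2).
have [[lip1 _ _] [lip2 _ _]] := (lg1, lg2).
apply: le_trans (weighted_length_concat ca lip1 lip2).
exact/dist_sqrt_le/(concat_lipschitz_curve lg1 lg2).
Qed.

(** A translated curve has the same velocity and a weight at most [k] times larger; this is applied
    to a nearly optimal curve. *)
Lemma dist_translate zeta k y z : 0 <= k ->
  (forall x, Num.sqrt (a (x + zeta)) <= k * Num.sqrt (a x)) ->
  dist (y + zeta) (z + zeta) <= k * dist y z.
Proof.
move=> k0 ak; apply/ler_addgt0Pr => e e0.
have k1 : 0 < k + 1 by rewrite ltr_wpDl.
(* The slack [e / (k + 1)] is still at most [e] after multiplication by [k], and is well defined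
   when [k] is 0. *)
have [gamma lg le] := dist_approx y z (divr_gt0 e0 k1).
pose delta t := gamma t + zeta.
have [lip g0 g1] := lg.
have ld : lipschitz_curve (y + zeta) (z + zeta) delta.
  split; rewrite /delta ?g0 ?g1//.
  move/lipschitz_itv01P : lip => [M HM]; apply/lipschitz_itv01P.
  by exists M => s t s01 t01; rewrite opprD addrACA subrr addr0 HM.
rewrite -lee_fin -distE; apply: le_trans (dist_sqrt_le ld) _.
have [W [mW W0 aeW wE]] := measurable_speed ca lip.
apply: (@le_trans _ _ (k%:E * weighted_length a gamma)%E); last first.
  apply: (@le_trans _ _ (k%:E * (dist y z + e / (k + 1))%:E)%E).
    by rewrite lee_wpmul2l// lee_fin.
  rewrite -EFinM lee_fin mulrDr lerD2l mulrCA ger_pMr// ler_pdivrMr// mul1r.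
  by rewrite lerDl.
rewrite wE -ge0_integralZl//; last 2 first.
- by apply/measurable_EFinP; exact: measurable_funTS.
- by move=> t _; rewrite lee_fin.
apply: integral_le_measurable_ae => //.
- by apply: measurable_funeM; apply/measurable_EFinP; exact: measurable_funTS.
- by move=> t _; rewrite lee_fin speed_ge0.
- by move=> t _; rewrite mule_ge0 ?lee_fin.
have aeF := ae_filter_ringOfSetsType mu.
apply: filterS aeW => t H /H[dg Wt]; rewrite -EFinM lee_fin -Wt /speed mulrA.
have -> : derive1 delta t = derive1 gamma t.
  suff E : (fun h => h^-1 *: (delta (h + t) - delta t)) =
      (fun h => h^-1 *: (gamma (h + t) - gamma t)) by rewrite /derive1 E.
  by apply/funext => h; rewrite /delta opprD addrACA subrr addr0.
by apply: ler_wpM2r; [exact: enorm_ge0|exact: ak].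
Qed.

End WeightedDistance.

(** * Asymptotic distance to hyperplanes for an almost translation-invariant metric *)

Section PlanarMetric.
Context {R : realType} {N : nat}.
Implicit Types (x y z nu zeta : 'rV[R]_N) (u v e : R).
Variables (d : 'rV[R]_N -> 'rV[R]_N -> R) (l L : R) (nu : 'rV[R]_N).
Hypotheses (l0 : 0 <= l) (L0 : 0 <= L) (nu1 : enorm nu = 1).
Hypothesis d_sym : forall y z, d y z = d z y.
Hypothesis d_triangle : forall y x z, d x z <= d x y + d y z.
Hypothesis d_le : forall y z, d y z <= L * enorm (z - y).
Hypothesis d_ge : forall y z, l * `|dot (z - y) nu| <= d y z.
Hypothesis d_translate : forall e, 0 < e -> exists C, forall w, exists2 zeta,
  enorm (zeta - w) <= C & forall y z, d (y + zeta) (z + zeta) <= (1 + e) * d y z.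

(** The level [u] is measured relative to [y], so that different base points can be compared at the
    same [u]. The infimum [plane_dist] is the D(y, u) of the opening comment. *)
Definition plane_set y u : set R := [set d y z | z in [set z | dot (y - z) nu = u]].

Definition plane_dist y u : R := inf (plane_set y u).

Let d_ge0 y z : 0 <= d y z.
Proof. by apply: le_trans (d_ge y z); rewrite mulr_ge0. Qed.

Let plane_set_shift y u : plane_set y u (d y (y - u *: nu)).
Proof.
exists (y - u *: nu) => //=; rewrite opprB addrCA subrr addr0 dotZl.
by rewrite dot_unit// mulr1.
Qed.

Let plane_has_inf y u : has_inf (plane_set y u).
Proof.
split; first by exists (d y (y - u *: nu)); exact: plane_set_shift.
by exists 0 => _ [z _ <-].
Qed.

Lemma plane_dist_le y z u : dot (y - z) nu = u -> plane_dist y u <= d y z.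
Proof. by move=> yz; apply: ge_inf; [case: (plane_has_inf y u)|exists z]. Qed.

Lemma plane_dist_approx y u e : 0 < e ->
  exists2 z, dot (y - z) nu = u & d y z <= plane_dist y u + e.
Proof.
move=> e0; have [_ [z yz <-] /ltW] := inf_adherent e0 (plane_has_inf y u).
by exists z.
Qed.

Lemma plane_dist_bounds y u : l * `|u| <= plane_dist y u <= L * `|u|.
Proof.
apply/andP; split.
  apply: lb_le_inf; first by case: (plane_has_inf y u).
  move=> _ [z /= <- <-]; rewrite -normrN -dotNl opprB; exact: d_ge.
apply: le_trans (ge_inf _ (plane_set_shift y u)) _.
  by case: (plane_has_inf y u).
apply: le_trans (d_le _ _) _.
by rewrite addrAC subrr add0r enormN enormZ nu1 mulr1.
Qed.

(** This is M(u). It is finite because D(y, u) is at most [L] times the absolute value of [u],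
    uniformly in [y]. *)
Definition max_plane_dist u : R := sup [set plane_dist y u | y in setT].

Let max_has_sup u : has_sup [set plane_dist y u | y in setT].
Proof.
split; first by exists (plane_dist 0 u), 0.
by exists (L * `|u|) => _ [y _ <-]; have /andP[] := plane_dist_bounds y u.
Qed.

Lemma plane_dist_le_max y u : plane_dist y u <= max_plane_dist u.
Proof. by apply: ub_le_sup; [case: (max_has_sup u)|exists y]. Qed.

Lemma max_plane_dist_le u r : (forall y, plane_dist y u <= r) -> max_plane_dist u <= r.
Proof.
move=> H; apply: ge_sup; first by case: (max_has_sup u).
by move=> _ [y _ <-].
Qed.

Lemma max_plane_dist_bounds u : l * `|u| <= max_plane_dist u <= L * `|u|.
Proof.
apply/andP; split.
  by apply: le_trans (plane_dist_le_max 0 u); have /andP[] := plane_dist_bounds 0 u.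
by apply: max_plane_dist_le => y; have /andP[] := plane_dist_bounds y u.
Qed.

(** A path first crosses [u] from [y] to some [z], then [v] from [z]. The second leg starts at an
    uncontrolled point, which is why the supremum over base points is taken. *)
Lemma max_plane_dist_subadditive u v :
  max_plane_dist (u + v) <= max_plane_dist u + max_plane_dist v.
Proof.
apply: max_plane_dist_le => y; apply/ler_addgt0Pr => e e0.
have e2 : 0 < e / 2 by rewrite divr_gt0.
have [z yz dyz] := plane_dist_approx y u e2.
have [w zw dzw] := plane_dist_approx z v e2.
have yw : dot (y - w) nu = u + v.
  by rewrite -yz -zw -dotDl addrA subrK.
have := plane_dist_le yw; have := d_triangle z y w.
have := plane_dist_le_max y u; have := plane_dist_le_max z v.
lra.
Qed.

(** A nearly optimal pair for [y] is moved by an almost period close to [y' - y]; connecting its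
    ends to [y'] and to the plane at level [u] below [y'] costs a bounded amount. *)
Lemma plane_dist_almost_invariant e : 0 < e -> exists C, forall y u,
  max_plane_dist u <= (1 + e) * plane_dist y u + C.
Proof.
move=> e0; have [C HC] := d_translate e0.
(* Each of the two connections costs at most [L * C]; the slack 1 in the choice of [z] is multiplied
   by [1 + e]. *)
exists (2 * L * C + (1 + e)) => y u; apply: max_plane_dist_le => y'.
have [z yz dyz] := plane_dist_approx y u ltr01.
have [zeta zC dz] := HC (y' - y).
(* The height error caused by using [zeta] instead of [y' - y]; moving the end point by [c *: nu]
   corrects it. *)
pose c := dot (y' - y - zeta) nu.
have cC : `|c| <= C.
  apply: le_trans (dot_le_enorm _ nu1) _.
  by rewrite -enormN opprB.
pose z' := z + zeta + c *: nu.
have yz' : dot (y' - z') nu = u.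
  rewrite -yz /z' !dotBl !dotDl dotZl dot_unit// /c !dotBl; ring.
have h1 := plane_dist_le yz'.
have h2 := d_triangle (y + zeta) y' z'.
have h3 := d_triangle (z + zeta) (y + zeta) z'.
have h4 : d y' (y + zeta) <= L * C.
  apply: le_trans (d_le _ _) _; rewrite ler_wpM2l//.
  suff -> : y + zeta - y' = zeta - (y' - y) by [].
  by rewrite opprB addrCA addrA.
have h5 : d (z + zeta) z' <= L * C.
  apply: le_trans (d_le _ _) _; rewrite ler_wpM2l//.
  by rewrite /z' addrAC subrr add0r enormZ nu1 mulr1.
have h6 := dz y z.
have h7 : (1 + e) * d y z <= (1 + e) * (plane_dist y u + 1).
  by rewrite ler_wpM2l// addr_ge0// ltW.
lra.
Qed.

(* Reversing a minimizing path exchanges its end points, hence [u] and [- u]. *)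
Lemma max_plane_distN e : 0 < e -> exists C, forall y u,
  max_plane_dist (- u) <= (1 + e) * plane_dist y u + C.
Proof.
move=> e0; have [C HC] := plane_dist_almost_invariant e0.
exists (1 + e + C) => y u.
have [z yz dyz] := plane_dist_approx y u ltr01.
have zy : dot (z - y) nu = - u by rewrite -yz -dotNl opprB.
have h := plane_dist_le zy; rewrite d_sym in h.
have h1 := HC z (- u).
have h2 : (1 + e) * plane_dist z (- u) <= (1 + e) * (plane_dist y u + 1).
  by rewrite ler_wpM2l ?addr_ge0 ?(ltW e0)//; lra.
lra.
Qed.

(** By Fekete's lemma this infimum is the limit c of M(u)/u; as an infimum it gives the lower bound
    on M with no error term. *)
Definition plane_speed : R := inf [set max_plane_dist u / u | u in [set u | 0 < u]].

Let plane_speed_has_inf : has_inf [set max_plane_dist u / u | u in [set u | 0 < u]].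
Proof.
split; first by exists (max_plane_dist 1 / 1), 1 => //=.
exists 0 => _ [u /= u0 <-]; rewrite divr_ge0 ?(ltW u0)//.
have /andP[+ _] := max_plane_dist_bounds u; apply: le_trans.
by rewrite mulr_ge0.
Qed.

Lemma plane_speed_le u : 0 < u -> plane_speed * u <= max_plane_dist u.
Proof.
move=> u0; rewrite -ler_pdivlMr//; apply: ge_inf; last by exists u.
by case: plane_speed_has_inf.
Qed.

Lemma plane_speed_bounds : l <= plane_speed <= L.
Proof.
apply/andP; split.
  apply: lb_le_inf; first by case: plane_speed_has_inf.
  move=> _ [u /= u0 <-]; rewrite ler_pdivlMr//.
  by have /andP[+ _] := max_plane_dist_bounds u; rewrite gtr0_norm.
have := plane_speed_le ltr01; rewrite mulr1 => h; apply: le_trans h _.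
by have /andP[_] := max_plane_dist_bounds 1; rewrite normr1 mulr1.
Qed.

(** Quantitative Fekete: with [u0] nearly attaining the infimum, copies of [u0] are subtracted from
    [u] by subadditivity until less than [u0] remains, at a cost of at most [L * u0]. *)
Lemma max_plane_dist_upper e : 0 < e -> exists C, forall u, 0 <= u ->
  max_plane_dist u <= (plane_speed + e) * u + C.
Proof.
move=> e0.
have [_ [u0 /= u0p <-] hu0] := inf_adherent e0 plane_speed_has_inf.
rewrite -/plane_speed in hu0.
have {}hu0 : max_plane_dist u0 <= (plane_speed + e) * u0.
  by rewrite -ler_pdivrMr// ltW.
have ce0 : 0 <= plane_speed + e.
  by have /andP[h _] := plane_speed_bounds; rewrite addr_ge0 ?(ltW e0)// (le_trans l0).
exists (L * u0) => u up.
have [n] : exists n, u < n.+1%:R * u0.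
  exists (Num.bound (u / u0)); rewrite -ltr_pdivrMr//.
  apply: lt_trans (archi_boundP _) _; first by rewrite divr_ge0// ltW.
  by rewrite ltr_nat.
(* Induction on a bound for the number of copies of [u0] contained in [u]. *)
elim: n u up => [|n IH] u up.
  rewrite mul1r => uu0.
  have /andP[_] := max_plane_dist_bounds u; rewrite ger0_norm// => h.
  apply: le_trans h _; rewrite -[leLHS]add0r lerD//; first exact: mulr_ge0.
  by rewrite ler_wpM2l// ltW.
move=> un; have [uu0|u0u] := ltP u u0.
  have /andP[_] := max_plane_dist_bounds u; rewrite ger0_norm// => h.
  apply: le_trans h _; rewrite -[leLHS]add0r lerD//; first exact: mulr_ge0.
  by rewrite ler_wpM2l// ltW.
have h1 : max_plane_dist (u - u0) <= (plane_speed + e) * (u - u0) + L * u0.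
  apply: IH; first by rewrite subr_ge0.
  by rewrite ltrBlDr -[in X in _ + X](mul1r u0) -mulrDl natr1.
have := max_plane_dist_subadditive (u - u0) u0; rewrite subrK.
lra.
Qed.

Lemma plane_dist_asymptotic e : 0 < e -> exists C, forall y u,
  `|plane_dist y u - plane_speed * `|u| | <= e * `|u| + C.
Proof.
move=> e0.
(* Chosen so that the relative error [f] on a distance of at most [L] times the height costs half of
   [e]; the added 1 allows [L] to be 0. *)
have f0 : 0 < e / 2 / (L + 1) by rewrite !divr_gt0// ltr_wpDl.
set f := e / 2 / (L + 1) in f0.
have fL : f * L <= e / 2.
  rewrite /f -mulrA ger_pMr ?divr_gt0// mulrC ler_pdivrMr ?ltr_wpDl// mul1r.
  by rewrite lerDl.
have [C1 H1] := plane_dist_almost_invariant f0.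
have [C2 H2] := max_plane_distN f0.
have [C3 H3] := max_plane_dist_upper (divr_gt0 e0 (ltr0Sn _ 1)).
have key y u : (1 + f) * plane_dist y u <= plane_dist y u + e / 2 * `|u|.
  rewrite mulrDl mul1r lerD2l.
  have /andP[_ h] := plane_dist_bounds y u.
  apply: (@le_trans _ _ (f * (L * `|u|))); first by rewrite ler_wpM2l// ltW.
  by rewrite mulrA ler_wpM2r.
exists (`|C1| + `|C2| + `|C3|) => y u.
have n1 := ler_norm C1; have n2 := ler_norm C2; have n3 := ler_norm C3.
have p1 := normr_ge0 C1; have p2 := normr_ge0 C2; have p3 := normr_ge0 C3.
rewrite ler_norml.
have [u0|u0|u0] := ltgtP u 0; last first.
- rewrite u0 normr0 !mulr0 subr0 add0r.
  have := plane_dist_bounds y 0; rewrite normr0 !mulr0 => /andP[a b].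
  by apply/andP; split; lra.
(* For [u > 0], both bounds come from D(y, u) <= M(u) <= (1 + f) D(y, u) + C1, with M(u) between c u
   and (c + e/2) u + C3. *)
- have h1 := plane_speed_le u0; have h2 := H1 y u; have h3 := H3 u (ltW u0).
  have h4 := plane_dist_le_max y u; have h5 := key y u.
  rewrite gtr0_norm// in h5 *.
  have e2u : 0 <= e / 2 * u by rewrite mulr_ge0// ltW// divr_gt0.
  by apply/andP; split; lra.
(* For [u < 0], the lower bound goes through M(-u) <= (1 + f) D(y, u) + C2. The upper bound goes
   through D(y, u) <= M(u) <= (1 + f) D(y, -u) + C2 and spends the second half of [e] on the
   reversal. *)
- have nu0 : 0 < - u by rewrite oppr_gt0.
  have h1 := plane_speed_le nu0; have h2 := H2 y u.
  have h3 := H3 _ (ltW nu0).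
  have h4 := H2 y (- u); rewrite opprK in h4.
  have h5 := key y u; have h6 := key y (- u).
  have h7 := plane_dist_le_max y u; have h8 := plane_dist_le_max y (- u).
  rewrite normrN in h6; rewrite ltr0_norm// in h5 h6 *.
  have e2u : 0 <= e / 2 * (- u) by rewrite mulr_ge0// ltW// divr_gt0.
  by apply/andP; split; lra.
Qed.

End PlanarMetric.

(** * Uniform convergence expressed by extended-real suprema *)

Section SupOn.
Context {R : realType} {N : nat}.
Implicit Types (K : set 'rV[R]_N) (f : 'rV[R]_N -> R).

Lemma sup_on_ge0 K f : (0 <= sup_on K f)%E.
Proof. by apply: ereal_sup_ubound; left. Qed.

Lemma sup_on_ub K f x : K x -> (`|f x|%:E <= sup_on K f)%E.
Proof. by move=> Kx; apply: ereal_sup_ubound; right; exists x. Qed.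

Lemma sup_on_le K f (r : R) : 0 <= r -> (forall x, K x -> `|f x| <= r) ->
  (sup_on K f <= r%:E)%E.
Proof.
move=> r0 fr; apply: ge_ereal_sup => _ [->|[x Kx <-]]; rewrite lee_fin//.
exact: fr.
Qed.

Lemma sup_on_cvg0P K (f : R -> 'rV[R]_N -> R) :
  sup_on K (f T) @[T --> +oo] --> 0%E <->
  forall e : R, 0 < e -> \forall T \near +oo, (sup_on K (f T) <= e%:E)%E.
Proof.
split=> [/fine_cvgP[fin cv] e e0|H].
  move/cvgrPdist_le : cv => /(_ _ e0) cv; near=> T.
  have finT : sup_on K (f T) \is a fin_num by near: T.
  rewrite -(fineK finT) lee_fin (le_trans (ler_norm _))//.
  rewrite -normrN -[X in `|X|]add0r.
  by near: T.
apply/fine_cvgP; split.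
  near=> T; rewrite ge0_fin_numE ?sup_on_ge0//.
  (* Any fixed tolerance, here 1, makes the supremum eventually finite. *)
  apply: (@le_lt_trans _ _ 1%:E); last exact: ltry.
  by near: T; exact: H.
apply/cvgrPdist_le => e e0; near=> T.
have le : (sup_on K (f T) <= e%:E)%E by near: T; exact: H.
have fin : sup_on K (f T) \is a fin_num.
  by rewrite ge0_fin_numE ?sup_on_ge0//; apply: le_lt_trans le (ltry _).
rewrite sub0r normrN ger0_norm /=; first by rewrite -lee_fin fineK.
by rewrite fine_ge0// sup_on_ge0.
Unshelve. all: by end_near. Qed.

Lemma eq_norm_sup_on K f g : (forall x, `|f x| = `|g x|) -> sup_on K f = sup_on K g.
Proof.
move=> fg; rewrite /sup_on; congr (ereal_sup (_ `|` _)).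
by apply: eq_imagel => x _; rewrite fg.
Qed.

End SupOn.

(** * Homogenization of the signed distance *)

Section Homogenization.
Context {R : realType} {N : nat}.
Implicit Types (x y z nu : 'rV[R]_N).
Variables (a : 'rV[R]_N -> R) (theta Theta : R).
Hypotheses (theta0 : 0 < theta) (apa : bohr_almost_periodic a).
Hypothesis abnd : forall x, theta <= a x <= Theta.

Let ca : continuous a. Proof. by case: apa. Qed.

Lemma dist_almost_translate e : 0 < e -> exists C, forall w, exists2 zeta,
  enorm (zeta - w) <= C & forall y z,
    dist a (y + zeta) (z + zeta) <= (1 + e) * dist a y z.
Proof.
move=> e0; have [_ _ H] := apa.
(* With tolerance [e * theta], at most [e * a x], the additive closeness of translates becomes a
   multiplicative bound: [a (x + zeta)] is at most [(1 + e) * a x], hence at most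
   [(1 + e) ^+ 2 * a x]. *)
have [tau tau0 Htau] := H _ (mulr_gt0 e0 theta0).
(* Half the diagonal of a cube of side [tau]. *)
exists (Num.sqrt N%:R * (tau / 2)) => w.
have [zeta cz /= sz] := Htau w; exists zeta.
  apply: enorm_le_coord; first by rewrite divr_ge0// ltW.
  by move=> i; rewrite !mxE; exact: cz.
move=> y z; apply: (dist_translate ca abnd); first by rewrite addr_ge0 ?(ltW e0).
move=> x; have e1 : 0 <= 1 + e by rewrite addr_ge0 ?(ltW e0).
have /andP[ax _] := abnd x.
rewrite -(ger0_norm e1) -sqrtr_sqr -sqrtrM ?sqr_ge0// ler_wsqrtr//.
have : `|a (x + zeta) - a x| <= e * theta.
  rewrite -lee_fin; apply: le_trans sz.
  exact: (@sup_on_ub _ _ setT (fun x => a (x + zeta) - a x)).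
move=> /(le_trans (ler_norm _)) h.
have h2 : e * theta <= e * a x by rewrite ler_wpM2l// ltW.
have h3 : 0 <= e * a x by rewrite mulr_ge0 ?(ltW e0)// (le_trans (ltW theta0)).
have h4 : 0 <= e ^+ 2 * a x by rewrite mulr_ge0 ?sqr_ge0// (le_trans (ltW theta0)).
have -> : (1 + e) ^+ 2 * a x = a x + e * a x + e * a x + e ^+ 2 * a x by ring.
lra.
Qed.

(** The points of the hyperplane through 0 are exactly those at level [dot y nu] relative to [y],
    and the infimum of finite nonnegative distances may be taken in the reals. *)
Lemma signed_distE nu y :
  signed_dist a nu y = Num.sg (dot y nu) * plane_dist (dist a) nu y (dot y nu).
Proof.
rewrite /signed_dist /plane_dist; congr (_ * _).
have -> : [set dist_sqrt a y z | z in hyperplane nu] =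
    EFin @` plane_set (dist a) nu y (dot y nu).
  apply/seteqP; split=> [_ [z zn <-]|_ [_ [z /= yz <-] <-]].
    exists (dist a y z); last by rewrite (distE abnd).
    by exists z => //=; rewrite dotBl zn subr0.
  exists z; last by rewrite (distE abnd).
  by rewrite /hyperplane /=; move: yz; rewrite dotBl; lra.
rewrite ereal_inf_EFin//.
  by exists 0 => _ [z _ <-]; exact: dist_ge0.
exists (dist a y 0), 0 => //=; by rewrite subr0.
Qed.

Lemma signed_distN nu y : signed_dist a (- nu) y = - signed_dist a nu y.
Proof.
rewrite /signed_dist dotNr sgrN mulNr; congr (- (_ * fine (ereal_inf _))).
rewrite (_ : hyperplane (- nu) = hyperplane nu)//.
by apply/seteqP; split=> z; rewrite /hyperplane/= dotNr; lra.
Qed.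

Let sqrt_theta_ge0 : 0 <= Num.sqrt theta. Proof. exact: sqrtr_ge0. Qed.
Let sqrt_Theta_ge0 : 0 <= Num.sqrt Theta. Proof. exact: sqrtr_ge0. Qed.

Definition limit_speed nu : R := plane_speed (dist a) nu.

Lemma limit_speed_bounds nu : enorm nu = 1 ->
  Num.sqrt theta <= limit_speed nu <= Num.sqrt Theta.
Proof.
move=> nu1; apply: (plane_speed_bounds sqrt_theta_ge0 nu1).
- exact: (dist_le_enorm abnd).
- by move=> y z; exact: (dist_ge_dot abnd).
Qed.

Lemma signed_dist_asymptotic nu e : enorm nu = 1 -> 0 < e -> exists C, forall y,
  `|signed_dist a nu y - limit_speed nu * dot y nu| <= e * `|dot y nu| + C.
Proof.
move=> nu1 e0.
have [C HC] := plane_dist_asymptotic sqrt_theta_ge0 sqrt_Theta_ge0 nu1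
  (dist_sym ca abnd) (dist_triangle ca abnd)
  (dist_le_enorm abnd)
  (fun y z => dist_ge_dot abnd y z nu1) dist_almost_translate e0.
exists C => y; apply: le_trans (HC y (dot y nu)).
(* Writing [dot y nu] as its sign times its absolute value factors out the sign, whose absolute
   value is at most 1. *)
rewrite signed_distE [X in _ - _ * X]numEsg mulrCA -mulrBr normrM.
rewrite ler_piMl//; rewrite normr_sg; by case: (_ != 0).
Qed.

Definition homogenizes nu (c : R) : Prop :=
  forall K : set 'rV[R]_N, compact K ->
    sup_on K (fun x => T^-1 * signed_dist a nu (T *: x) - c * dot x nu)
      @[T --> +oo] --> 0%E.

(** At the point [T *: x] the asymptotic error has a part linear in [T] with a small coefficient and
    a bounded part; dividing by [T] leaves both small, uniformly for bounded [dot x nu]. *)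
Lemma limit_speed_homogenizes nu : enorm nu = 1 -> homogenizes nu (limit_speed nu).
Proof.
move=> nu1 K cK; apply/sup_on_cvg0P => e e0.
have [B B0 KB] : exists2 B : R, 0 < B & forall x, K x -> `|dot x nu| <= B.
  have [M [Mr HM]] := compact_bounded cK.
  (* The inner 1 is there because compactness bounds the norm by every constant strictly above [M];
     the outer 1 makes [B] positive. *)
  exists (Num.sqrt N%:R * (`|M| + 1) + 1).
    by rewrite ltr_wpDl// mulr_ge0 ?sqrtr_ge0.
  move=> x Kx; apply: le_trans (dot_le_enorm _ nu1) _.
  apply: (@le_trans _ _ (Num.sqrt N%:R * (`|M| + 1))); last by rewrite lerDl.
  apply: enorm_le_coord => // i; apply: le_trans (coord_le_norm _ _) _.
  by apply: HM => //; rewrite (le_lt_trans (ler_norm M))// ltrDl.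
have f0 : 0 < e / 2 / B by rewrite !divr_gt0.
have [C HC] := signed_dist_asymptotic nu1 f0.
near=> T.
have T0 : 0 < T by near: T; exact: nbhs_pinfty_gt.
have TC : `|C| <= e / 2 * T.
  rewrite mulrC -ler_pdivrMr ?divr_gt0//; near: T; exact: nbhs_pinfty_ge.
apply: sup_on_le; first exact: ltW.
move=> x Kx.
have -> : T^-1 * signed_dist a nu (T *: x) - limit_speed nu * dot x nu =
    T^-1 * (signed_dist a nu (T *: x) - limit_speed nu * dot (T *: x) nu).
  by rewrite dotZl; field; rewrite gt_eqF.
rewrite normrM gtr0_norm ?invr_gt0// mulrC ler_pdivrMr//.
apply: le_trans (HC _) _; rewrite dotZl normrM gtr0_norm//.
have h1 : e / 2 / B * (T * `|dot x nu|) <= e / 2 * T.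
  rewrite mulrCA [leRHS]mulrC ler_wpM2l ?(ltW T0)//.
  by rewrite -[leRHS](divfK (lt0r_neq0 B0)) ler_wpM2l ?KB// ltW.
have := ler_norm C; lra.
Unshelve. all: by end_near. Qed.

(** Testing on the compact set [[set nu]], where the inner product is 1, makes both constants limits
    of the same quantity. *)
Lemma homogenizes_unique nu c1 c2 : enorm nu = 1 ->
  homogenizes nu c1 -> homogenizes nu c2 -> c1 = c2.
Proof.
move=> nu1 h1 h2; apply/eqP; rewrite -subr_eq0 -normr_le0.
apply/ler_addgt0Pr => e e0; rewrite add0r.
have e2 : 0 < e / 2 by rewrite divr_gt0.
have /sup_on_cvg0P/(_ _ e2) H1 := h1 [set nu] (@compact_set1 _ nu).
have /sup_on_cvg0P/(_ _ e2) H2 := h2 [set nu] (@compact_set1 _ nu).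
near +oo_R => T.
have G1 : (sup_on [set nu] (fun x => T^-1 * signed_dist a nu (T *: x)
  - c1 * dot x nu)%R <= (e / 2)%:E)%E by near: T.
have G2 : (sup_on [set nu] (fun x => T^-1 * signed_dist a nu (T *: x)
  - c2 * dot x nu)%R <= (e / 2)%:E)%E by near: T.
have := le_trans (sup_on_ub _ (erefl nu)) G1.
have := le_trans (sup_on_ub _ (erefl nu)) G2.
rewrite !lee_fin dot_unit// !mulr1 => k2 k1.
set s := T^-1 * _ in k1 k2.
have -> : c1 - c2 = (s - c2) - (s - c1) by ring.
by apply: le_trans (ler_normB _ _) _; lra.
Unshelve. all: by end_near. Qed.

(** Replacing [nu] by its opposite changes the sign of both the signed distance and the linear term,
    so the absolute error is the same. *)
Lemma homogenizesN nu c : homogenizes (- nu) c -> homogenizes nu c.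
Proof.
move=> H K /H; under eq_fun => T.
  rewrite (@eq_norm_sup_on _ _ _ _
    (fun x => T^-1 * signed_dist a nu (T *: x) - c * dot x nu)); last first.
    by move=> x; rewrite signed_distN dotNr !mulrN -opprD normrN.
  over.
by [].
Qed.

End Homogenization.

Theorem theorem1p5 (R : realType) (N : nat) (theta Theta : R)
    (a : 'rV[R]_N -> R) (hN : (2 <= N)%N)
    (htheta : 0 < theta) (hTheta : theta < Theta)
    (ha : bohr_almost_periodic a) (hbnd : forall x, theta <= a x <= Theta) :
  exists c : 'rV[R]_N -> R, forall nu : 'rV[R]_N, enorm nu = 1 ->
    unique (fun c0 : R => Num.sqrt theta <= c0 <= Num.sqrt Theta /\
      forall K : set 'rV[R]_N, compact K ->
        sup_on K (fun x => T^-1 * signed_dist a nu (T *: x) - c0 * dot x nu)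
          @[T --> +oo] --> 0%E) (c nu)
    /\ c nu = c (- nu).
Proof.
exists (limit_speed a) => nu nu1.
have h := limit_speed_homogenizes htheta ha hbnd nu1.
split; first split.
- by split; [exact: limit_speed_bounds|exact: h].
- by move=> c' [_ h']; exact: homogenizes_unique h h'.
(* The constant of [- nu] also homogenizes [nu], so uniqueness gives the evenness. *)
apply: (homogenizes_unique nu1 h); apply: homogenizesN.
by apply: (limit_speed_homogenizes htheta ha hbnd); rewrite enormN.
Qed.
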